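(* Let $\mathbb{M}\subset\mathbb{R}^d$ be a smooth compact embedded submanifold with tubular neighborhood $U_\delta^{\mathbb{M}}$, let $r:U_\delta^{\mathbb{M}}\to\mathbb{M}$ be a retraction, let $g:(-\epsilon,\epsilon)\times\mathbb{M}\to\mathbb{R}^d$ satisfy $g(s,\zeta)\in T_\zeta\mathbb{M}$, and let $G(s,z):=g(s,r(z))$ with $G(s,\cdot)\in C^\ell(U_\delta^{\mathbb{M}})$ for each $s\in(-\epsilon,\epsilon)$. Let $z:I\to\mathbb{M}$ be the solution of $\dot z(s)=G(s,z(s))$, $z(0)=\zeta_0\in\mathbb{M}$. Suppose there is a constant $C_r$ such that $|x-r(x)|\le C_r\min_{w\in\mathbb{M}}|x-w|$ for all $x\in U_\delta^{\mathbb{M}}$ (near closest point property). Let $\tilde\Phi_{RK}$ be the increment function of the ambient-space Runge–Kutta method for $G$ described in the context. Let $t\in I$ and $h_t>0$ with $t+h_t\in I$ be such that the time step satisfies $$h_t\Bigl|\sum_{b=1}^m\beta_{j,b}k_b(t,z(t),h_t)\Bigr|<\delta\quad(j=1,\dots,m),\qquad h_t\Bigl|\sum_{b=1}^m\gamma_bk_b(t,z(t),h_t)\Bigr|<\delta,$$ and suppose the Runge–Kutta method has consistency order $\ell$: $$\bigl|z(t+h_t)-\bigl(z(t)+h_t\tilde\Phi_{RK}(t,z(t),h_t)\bigr)\bigr|\le C_{\mathrm{RK}}h_t^{\ell+1}.$$ Then $$\bigl|z(t+h_t)-r\bigl(z(t)+h_t\tilde\Phi_{RK}(t,z(t),h_t)\bigr)\bigr|\le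 C_{\mathrm{RK}}(C_r+1)h_t^{\ell+1}.$$
   Context: $|\cdot|$ is the Euclidean norm. The normal bundle is $N\mathbb{M}=\{(\xi,v)\in\mathbb{R}^d\times\mathbb{R}^d:\xi\in\mathbb{M},\ v\in N_\xi\mathbb{M}\}$, where $N_\xi\mathbb{M}$ is the orthogonal complement of $T_\xi\mathbb{M}$ in $\mathbb{R}^d$; $E(\xi,v)=\xi+v$; $V_\delta=\{(\xi,v)\in N\mathbb{M}:|v|<\delta\}$. $\delta>0$ is such that $E$ restricted to $V_\delta$ is a diffeomorphism onto its image, and $U_\delta^{\mathbb{M}}:=E(V_\delta)$ is the tubular neighborhood. A retraction is a map $r:U_\delta^{\mathbb{M}}\to\mathbb{M}$ with $r|_{\mathbb{M}}=\mathrm{id}$. Runge–Kutta method: given real weights $\alpha_j,\beta_{j,b},\gamma_b$ ($j,b=1,\dots,m$), the stages are $$k_j(t,\eta,h)=G\Bigl(t+\alpha_jh,\ \eta+h\sum_{b=1}^m\beta_{j,b}k_b(t,\eta,h)\Bigr),\quad j=1,\dots,m,$$ (determined recursively when the method is explicit, i.e. $\beta_{j,b}=0$ for $b\ge j$; the times $t+\alpha_jh$ are assumed to lie in $(-\epsilon,\epsilon)$), and $\tilde\Phi_{RK}(t,\eta,h)=\sum_{b=1}^m\gamma_bk_b(t,\eta,h)$. $I\subset(-\epsilon,\epsilon)$ is the interval of existence of the solution $z$, which takes values in $\mathbb{M}$. *)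

(* Defs.v *)
From mathcomp Require Import all_boot all_order all_algebra.
From mathcomp Require Import all_classical all_reals all_analysis.
Set Implicit Arguments.
Unset Strict Implicit.
Unset Printing Implicit Defensive.
Import Order.TTheory GRing.Theory Num.Theory.
Import numFieldNormedType.Exports.
Local Open Scope classical_set_scope.
Local Open Scope ring_scope.

(* The library norm on 'rV[R]_d is the sup norm; it induces the Euclidean
   topology, so that only the metric notions need [enorm]. *)
Definition edot {R : realType} {d : nat} (x y : 'rV[R]_d) : R :=
  \sum_(i < d) x 0 i * y 0 i.

Definition enorm {R : realType} {d : nat} (x : 'rV[R]_d) : R :=
  Num.sqrt (edot x x).

(* [Ck k U f]: f is of class C^k on the open set U. In finite dimension it is
   equivalent to quantify over all directions v or over a basis. *)
Fixpoint Ck {R : realType} {V W : normedModType R} (k : nat) (U : set V)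
    (f : V -> W) : Prop :=
  match k with
  | 0%N => forall x, U x -> {for x, continuous f}
  | k'.+1 => (forall x, U x -> differentiable f x) /\
             (forall v : V, Ck k' U (fun x => 'D_v f x))
  end.

(* Smoothness on an arbitrary subset A of a Euclidean space: f extends, locally
   around every point of A, to a smooth map on an open set. When A is open this
   is C^oo on A; when A is an embedded submanifold it is smoothness for the
   induced manifold structure. *)
Definition smooth_on {R : realType} {V W : normedModType R} (A : set V)
    (f : V -> W) : Prop :=
  forall x, A x -> exists (U : set V) (F : V -> W),
    [/\ open U, U x, forall k, Ck k U F &
        forall y, A y -> U y -> F y = f y].

Definition diffeo_onto_image {R : realType} {V W : normedModType R}
    (A : set V) (f : V -> W) : Prop :=
  smooth_on A f /\
  exists2 g : W -> V, smooth_on (f @` A) g & forall x, A x -> g (f x) = x.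

(* Around each of its points M is, in suitable smooth coordinates phi of the
   ambient space, the slice where all but the first n coordinates vanish. *)
Definition embedded_submanifold {R : realType} {d : nat} (n : nat)
    (M : set 'rV[R]_d) : Prop :=
  (n <= d)%N /\
  forall p, M p -> exists (U : set 'rV[R]_d) (phi : 'rV[R]_d -> 'rV[R]_d),
    [/\ open U, U p, open (phi @` U), diffeo_onto_image U phi &
        forall x, U x ->
          (M x <-> forall i : 'I_d, (n <= i)%N -> phi x 0 i = 0)].

(* T_xi M, as the set of velocities at xi of smooth curves in M. *)
Definition tangent_space {R : realType} {d : nat} (M : set 'rV[R]_d)
    (xi : 'rV[R]_d) : set 'rV[R]_d :=
  [set v | exists (e : R) (c : R^o -> 'rV[R]_d),
    [/\ 0 < e, smooth_on [set s : R^o | - e < s < e] c,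
        forall s, - e < s < e -> M (c s), c 0 = xi & 'D_1 c 0 = v]].

Definition normal_space {R : realType} {d : nat} (M : set 'rV[R]_d)
    (xi : 'rV[R]_d) : set 'rV[R]_d :=
  [set v | forall w, tangent_space M xi w -> edot v w = 0].

Definition normal_bundle {R : realType} {d : nat} (M : set 'rV[R]_d) :
    set ('rV[R]_d * 'rV[R]_d) :=
  [set p | M p.1 /\ normal_space M p.1 p.2].

Definition endpoint_map {R : realType} {d : nat} (p : 'rV[R]_d * 'rV[R]_d) :
  'rV[R]_d := p.1 + p.2.

Definition normal_disc_bundle {R : realType} {d : nat} (M : set 'rV[R]_d)
    (delta : R) : set ('rV[R]_d * 'rV[R]_d) :=
  [set p | normal_bundle M p /\ enorm p.2 < delta].

Definition tubular_nbhd {R : realType} {d : nat} (M : set 'rV[R]_d)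
    (delta : R) : set 'rV[R]_d :=
  endpoint_map @` normal_disc_bundle M delta.

Definition is_retraction {R : realType} {d : nat} (U M : set 'rV[R]_d)
    (r : 'rV[R]_d -> 'rV[R]_d) : Prop :=
  (forall x, U x -> M (r x)) /\ (forall x, M x -> r x = x).

(* For compact nonempty M the infimum is a minimum. *)
Definition dist_to {R : realType} {d : nat} (M : set 'rV[R]_d)
    (x : 'rV[R]_d) : R :=
  inf [set enorm (x - w) | w in M].

(* z has derivative v at s relative to I: the usual derivative at interior
   points of I, the one-sided one at endpoints belonging to I. *)
Definition has_deriv_within {R : realType} {d : nat} (I : set R)
    (z : R -> 'rV[R]_d) (s : R) (v : 'rV[R]_d) : Prop :=
  (y - s)^-1 *: (z y - z s) @[y --> within I s^'] --> v.

Definition ode_solution {R : realType} {d : nat} (I : set R)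
    (M : set 'rV[R]_d) (G : R -> 'rV[R]_d -> 'rV[R]_d) (zeta0 : 'rV[R]_d)
    (z : R -> 'rV[R]_d) : Prop :=
  [/\ forall s, I s -> M (z s),
      forall s, I s -> has_deriv_within I z s (G s (z s)) &
      z 0 = zeta0].

Section RungeKutta.
Context {R : realType} {d m : nat}.
Variables (G : R -> 'rV[R]_d -> 'rV[R]_d).
Variables (alpha : 'I_m -> R) (beta : 'I_m -> 'I_m -> R) (gamma : 'I_m -> R).
Variable k : 'I_m -> R -> 'rV[R]_d -> R -> 'rV[R]_d.

(* The stage equations at (t, eta, h); beta is not required to be strictly
   lower triangular, so that implicit methods are included. *)
Definition RK_stages (t : R) (eta : 'rV[R]_d) (h : R) : Prop :=
  forall j : 'I_m,
    k j t eta h =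
    G (t + alpha j * h) (eta + h *: \sum_(b < m) beta j b *: k b t eta h).

Definition RK_increment (t : R) (eta : 'rV[R]_d) (h : R) : 'rV[R]_d :=
  \sum_(b < m) gamma b *: k b t eta h.

End RungeKutta.

(* Main.v *)
Require Import Defs.
From mathcomp Require Import all_boot all_order all_algebra.
From mathcomp Require Import all_classical all_reals all_analysis.
From mathcomp Require Import ring lra.
Import Order.TTheory GRing.Theory Num.Theory.
Import numFieldNormedType.Exports.
Local Open Scope classical_set_scope.
Local Open Scope ring_scope.

(** The point [x] reached by the Runge-Kutta step lies at Euclidean distance
    less than [delta] from [z t], a point of [M]. Such a point belongs to the
    tubular neighbourhood ([tubular_nbhd_near]): by compactness [M] has a point
    [p] nearest to [x], the vector [x - p] is no longer than the distance from
    [x] to [z t], and it is normal to [M] at [p] because the squared distance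
    to [x] along any curve of [M] through [p] is stationary there
    ([nearest_point_normal]). Hence the near closest point property applies at
    [x]. As [z (t + h)] is in [M], the distance from [x] to [M] is at most
    the consistency error [e], the norm of [z (t + h) - x], so that
    [x - r x] has norm at most [C_r * e] and the triangle inequality bounds
    the projected error by [(1 + C_r) * e].

    Bounding [C_r * dist_to M x] by [C_r * e] requires [0 <= C_r]. A negative
    [C_r] would force [x = r x] on the whole tubular neighbourhood, which
    would then be contained in [M]; but a compact set in positive dimension
    has points of its complement arbitrarily close to it
    ([compact_near_complement]). *)

(** * The Euclidean inner product and norm *)

Lemma edotC {R : realType} {d : nat} (x y : 'rV[R]_d) : edot x y = edot y x.
Proof. by apply: eq_bigr => i _; rewrite mulrC. Qed.

Lemma edotDl {R : realType} {d : nat} (x y u : 'rV[R]_d) :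
  edot (x + y) u = edot x u + edot y u.
Proof.
by rewrite /edot -big_split; apply: eq_bigr => i _; rewrite /= mxE mulrDl.
Qed.

Lemma edotZl {R : realType} {d : nat} (a : R) (x u : 'rV[R]_d) :
  edot (a *: x) u = a * edot x u.
Proof.
by rewrite /edot mulr_sumr; apply: eq_bigr => i _; rewrite /= mxE mulrA.
Qed.

Lemma edot_ge0 {R : realType} {d : nat} (x : 'rV[R]_d) : 0 <= edot x x.
Proof. by apply: sumr_ge0 => i _; rewrite -expr2 sqr_ge0. Qed.

Lemma edot_eq0 {R : realType} {d : nat} {x : 'rV[R]_d} :
  edot x x = 0 -> x = 0.
Proof.
move=> /eqP; rewrite psumr_eq0 => [/allP x0|i _]; last first.
  by rewrite -expr2 sqr_ge0.
apply/rowP => i; rewrite mxE.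
by have := x0 i (mem_index_enum i); rewrite mulf_eq0 orbb => /eqP.
Qed.

Lemma sqr_enorm {R : realType} {d : nat} (x : 'rV[R]_d) :
  enorm x ^+ 2 = edot x x.
Proof. by rewrite sqr_sqrtr// edot_ge0. Qed.

Lemma enorm_ge0 {R : realType} {d : nat} (x : 'rV[R]_d) : 0 <= enorm x.
Proof. exact: sqrtr_ge0. Qed.

Lemma enorm_eq0 {R : realType} {d : nat} {x : 'rV[R]_d} :
  enorm x = 0 -> x = 0.
Proof. by move=> x0; apply: edot_eq0; rewrite -sqr_enorm x0 expr0n. Qed.

Lemma enormZ {R : realType} {d : nat} (a : R) (x : 'rV[R]_d) :
  enorm (a *: x) = `|a| * enorm x.
Proof.
rewrite /enorm edotZl edotC edotZl mulrA -expr2 sqrtrM ?sqr_ge0//.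
by rewrite sqrtr_sqr.
Qed.

Lemma enormN {R : realType} {d : nat} (x : 'rV[R]_d) : enorm (- x) = enorm x.
Proof. by rewrite -scaleN1r enormZ normrN1 mul1r. Qed.

Lemma edot_le_enorm {R : realType} {d : nat} (x y : 'rV[R]_d) :
  edot x y <= enorm x * enorm y.
Proof.
have [->|y0] := eqVneq y 0.
  rewrite -[0 : 'rV_d](scale0r 0) edotC edotZl mul0r.
  by rewrite mulr_ge0// enorm_ge0.
have yy : 0 < edot y y.
  by rewrite lt_def edot_ge0 andbT; apply: contra_neq y0 => /edot_eq0.
apply: le_trans (ler_norm _) _.
rewrite -ler_sqr ?nnegrE ?mulr_ge0 ?enorm_ge0//.
rewrite exprMn !sqr_enorm real_normK ?num_real//.
(* the vector is [edot y y] times the component of [x] orthogonal to [y] *)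
have := edot_ge0 (edot y y *: x + (- edot x y) *: y).
rewrite edotDl !edotZl ![edot _ (_ + _)]edotC !edotDl !edotZl (edotC y x).
rewrite (_ : _ + _ = edot y y * (edot x x * edot y y - edot x y ^+ 2)).
  by rewrite pmulr_rge0// subr_ge0.
by ring.
Qed.

Lemma ler_enormD {R : realType} {d : nat} (x y : 'rV[R]_d) :
  enorm (x + y) <= enorm x + enorm y.
Proof.
rewrite -ler_sqr ?nnegrE ?addr_ge0 ?enorm_ge0//.
rewrite sqrrD !sqr_enorm edotDl ![edot _ (_ + _)]edotC !edotDl (edotC y x).
by have := edot_le_enorm x y; lra.
Qed.

Lemma continuous_sqdist {R : realType} {d : nat} (x : 'rV[R]_d) :
  continuous (fun w : 'rV[R]_d => edot (x - w) (x - w)).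
Proof.
move=> w; rewrite /edot /continuous_at.
elim: (index_enum 'I_d) => [|i s IHs].
  rewrite (_ : (fun w => _) = cst 0); last by apply/funext => u; rewrite big_nil.
  by rewrite big_nil; exact: cst_continuous.
rewrite big_cons; under eq_fun do rewrite big_cons.
have ci : {for w, continuous (fun u : 'rV[R]_d => (x - u) 0 i)}.
  rewrite (_ : (fun u => _) = (fun u : 'rV[R]_d => x 0 i - u 0 i)).
    by apply: continuousB; [exact: cst_continuous|exact: coord_continuous].
  by apply/funext => u; rewrite !mxE.
by apply: cvgD IHs; exact: cvgM.
Qed.

(** * Points of a compact set nearest to a given point *)

Lemma compact_nearest_point {R : realType} {d : nat} {M : set 'rV[R]_d}
    (x : 'rV[R]_d) :
  compact M -> M !=set0 ->
  exists2 p, M p & forall w, M w -> enorm (x - p) <= enorm (x - w).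
Proof.
move=> cM M0.
have [|p /set_mem Mp minp] :=
  EVT_min_rV (f := fun w => edot (x - w) (x - w)) M0 cM.
  exact/continuous_subspaceT/continuous_sqdist.
by exists p => // w Mw; rewrite /enorm ler_sqrt ?edot_ge0// minp// inE.
Qed.

Lemma smooth_on_derivable {R : realType} {V W : normedModType R} {A : set V}
    {f : V -> W} {x : V} (v : V) :
  open A -> smooth_on A f -> A x -> derivable f x v.
Proof.
move=> oA sf Ax; have [U [F [oU Ux FC FE]]] := sf x Ax.
have [dF _] := FC 1%N.
apply: (@near_eq_derivable _ _ _ F); last exact/diff_derivable/dF.
have nA : \forall y \near x, A y by exact: open_nbhs_nbhs.
have nU : \forall y \near x, U y by exact: open_nbhs_nbhs.
by near do apply: FE.
Unshelve. all: by end_near. Qed.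

Lemma is_derive_sqdist {R : realType} {d : nat} (x : 'rV[R]_d)
    {c : R^o -> 'rV[R]_d} {s : R} :
  derivable c s 1 ->
  is_derive s 1 (fun u => edot (x - c u) (x - c u))
    (- 2 * edot (x - c s) ('D_1 c s)).
Proof.
move=> dc; rewrite (derive_mx dc).
have di i : is_derive s 1 (fun u => (x - c u) 0 i)
    (- 'D_1 (fun u => c u 0 i) s).
  rewrite (_ : (fun u => _) = cst (x 0 i) - (fun u => c u 0 i)); last first.
    by apply/funext => u; rewrite !mxE.
  rewrite -[X in is_derive _ _ _ X]sub0r; apply: is_deriveB.
  by apply: derivableP; have /derivable_mxP := dc; exact.
rewrite (_ : (fun u => _) =
  \sum_(i < d) ((fun u => (x - c u) 0 i) * (fun u => (x - c u) 0 i))); last first.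
  by apply/funext => u; rewrite fct_sumE.
apply: is_derive_eq; rewrite mulr_sumr; apply: eq_bigr => i _ /=.
by rewrite !mxE /GRing.scale /=; ring.
Qed.

(** Along a curve of [M] through [p] the squared distance to [x] has a minimum
    at [p], so its derivative, [- 2 * edot (x - p) v] for a curve of velocity
    [v], vanishes. *)
Lemma nearest_point_normal {R : realType} {d : nat} {M : set 'rV[R]_d}
    {x p : 'rV[R]_d} :
  (forall w, M w -> enorm (x - p) <= enorm (x - w)) ->
  Defs.normal_space M p (x - p).
Proof.
move=> minp v [e [c [e0 sc Mc c0 <-]]].
have oA : open [set s : R^o | - e < s < e].
  rewrite (_ : [set s | _] = `]- e, e[%classic); first exact: interval_open.
  by apply/seteqP; split => s /=; rewrite in_itv.
have dc s : - e < s < e -> derivable c s 1.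
  by move=> se; exact: smooth_on_derivable oA sc se.
have e0e : - e < 0 < e by rewrite oppr_lt0 e0.
have : is_derive (0 : R) 1 (fun u => edot (x - c u) (x - c u)) 0.
  apply: (@derive1_at_min _ _ (- e) e); [by lra| | |].
  - move=> s; rewrite in_itv => /= /dc ds.
    by have := is_derive_sqdist x ds; case.
  - by rewrite in_itv.
  - move=> s; rewrite in_itv => /= /Mc Ms.
    by rewrite -!sqr_enorm ler_sqr ?nnegrE ?enorm_ge0// c0 minp.
move=> [_ D0]; have [_] := is_derive_sqdist x (dc 0 e0e).
by rewrite D0 c0; lra.
Qed.

(** * Tubular neighbourhoods and distance to a set *)

Lemma tubular_nbhd_near {R : realType} {d : nat} {M : set 'rV[R]_d}
    {delta : R} {w x : 'rV[R]_d} :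
  compact M -> M w -> enorm (x - w) < delta -> tubular_nbhd M delta x.
Proof.
move=> cM Mw xw.
have [p Mp minp] := compact_nearest_point x cM (ex_intro _ w Mw).
exists (p, x - p); last by rewrite /endpoint_map /= subrKC.
split=> /=; last exact: le_lt_trans (minp w Mw) xw.
by split=> //=; exact: nearest_point_normal.
Qed.

Lemma dist_to_le {R : realType} {d : nat} {M : set 'rV[R]_d}
    {x w : 'rV[R]_d} : M w -> dist_to M x <= enorm (x - w).
Proof.
move=> Mw; apply: ge_inf; last by exists w.
by exists 0 => _ [u _ <-]; exact: enorm_ge0.
Qed.

Lemma dist_to_ge0 {R : realType} {d : nat} {M : set 'rV[R]_d}
    {x : 'rV[R]_d} : M !=set0 -> 0 <= dist_to M x.
Proof.
move=> [w Mw]; apply: lb_le_inf; first by exists (enorm (x - w)), w.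
by move=> _ [u _ <-]; exact: enorm_ge0.
Qed.

(** Moving from a point of [M] with maximal first coordinate in the direction
    that increases this coordinate leaves [M] at once. *)
Lemma compact_near_complement {R : realType} {d : nat} {M : set 'rV[R]_d}
    {delta : R} :
  (0 < d)%N -> compact M -> M !=set0 -> 0 < delta ->
  exists w x, [/\ M w, ~ M x & enorm (x - w) < delta].
Proof.
case: d M => // d M _ cM M0 delta0.
have [|p /set_mem Mp maxp] := EVT_max_rV (f := fun w => w 0 ord0) M0 cM.
  exact/continuous_subspaceT/coord_continuous.
exists p, (p + (delta / 2) *: delta_mx 0 ord0); split=> //.
  by move=> /mem_set /maxp; rewrite !mxE !eqxx /=; lra.
have -> : p + (delta / 2) *: delta_mx 0 ord0 - p =
    (delta / 2) *: delta_mx 0 ord0 :> 'rV[R]_d.+1 by rewrite addrAC subrr add0r.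
have -> : enorm ((delta / 2) *: (delta_mx 0 ord0 : 'rV[R]_d.+1)) = delta / 2.
  rewrite enormZ /enorm /edot big_ord_recl big1 => [|i _]; last first.
    by rewrite !mxE /= mulr0.
  by rewrite !mxE !eqxx /= mulr1 addr0 sqrtr1 mulr1 gtr0_norm ?divr_gt0.
by lra.
Qed.

Lemma near_closest_point_const_ge0 {R : realType} {d : nat}
    {M : set 'rV[R]_d} {delta C : R} {r : 'rV[R]_d -> 'rV[R]_d} :
  (0 < d)%N -> compact M -> M !=set0 -> 0 < delta ->
  is_retraction (tubular_nbhd M delta) M r ->
  (forall x, tubular_nbhd M delta x -> enorm (x - r x) <= C * dist_to M x) ->
  0 <= C.
Proof.
move=> d0 cM M0 delta0 [rM _] hC; rewrite leNgt; apply/negP => C0.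
have [w [x [Mw nMx xw]]] := compact_near_complement d0 cM M0 delta0.
have Ux := tubular_nbhd_near cM Mw xw.
apply: nMx; suff -> : x = r x by exact: rM.
apply/subr0_eq/enorm_eq0/le_anti; rewrite enorm_ge0 andbT.
by apply: le_trans (hC x Ux) _; rewrite nmulr_rle0// dist_to_ge0.
Qed.

(** * The error estimate *)

Theorem lemma4p1 (R : realType) (d n m l : nat) (M : set 'rV[R]_d)
    (delta eps : R) (r : 'rV[R]_d -> 'rV[R]_d)
    (g G : R -> 'rV[R]_d -> 'rV[R]_d)
    (I : set R) (z : R -> 'rV[R]_d) (zeta0 : 'rV[R]_d)
    (C_r C_RK : R)
    (alpha : 'I_m -> R) (beta : 'I_m -> 'I_m -> R) (gamma : 'I_m -> R)
    (k : 'I_m -> R -> 'rV[R]_d -> R -> 'rV[R]_d)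
    (t h : R)
    (hd : (0 < d)%N)
    (hM : embedded_submanifold n M)
    (hMc : compact M)
    (hdelta : 0 < delta)
    (hE : diffeo_onto_image (normal_disc_bundle M delta) endpoint_map)
    (hr : is_retraction (tubular_nbhd M delta) M r)
    (heps : 0 < eps)
    (hg : forall s : R, - eps < s < eps -> forall zeta, M zeta ->
            tangent_space M zeta (g s zeta))
    (hG : forall (s : R) (x : 'rV[R]_d), - eps < s < eps ->
            tubular_nbhd M delta x -> G s x = g s (r x))
    (hGl : forall s : R, - eps < s < eps -> Ck l (tubular_nbhd M delta) (G s))
    (hI : is_interval I)
    (hI0 : I 0)
    (hIeps : forall s, I s -> - eps < s < eps)
    (hzeta0 : M zeta0)
    (hz : ode_solution I M G zeta0 z)
    (hCr : forall x, tubular_nbhd M delta x ->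
            enorm (x - r x) <= C_r * dist_to M x)
    (ht : I t)
    (hh : 0 < h)
    (hth : I (t + h))
    (htimes : forall j, - eps < t + alpha j * h < eps)
    (hk : RK_stages G alpha beta k t (z t) h)
    (hstep_stages : forall j,
            h * enorm (\sum_(b < m) beta j b *: k b t (z t) h) < delta)
    (hstep_increment :
            h * enorm (\sum_(b < m) gamma b *: k b t (z t) h) < delta)
    (hconsistency :
            enorm (z (t + h) - (z t + h *: RK_increment gamma k t (z t) h))
            <= C_RK * h ^+ l.+1) :
  enorm (z (t + h) - r (z t + h *: RK_increment gamma k t (z t) h))
  <= C_RK * (C_r + 1) * h ^+ l.+1.
Proof.
move: hconsistency; set x := z t + _ => hx.
have [zM _ _] := hz.
have Mt := zM t ht; have Mth := zM _ hth.
have Ux : tubular_nbhd M delta x.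
  apply: tubular_nbhd_near hMc Mt _.
  by rewrite /x addrAC subrr add0r enormZ gtr0_norm.
have Cr0 : 0 <= C_r.
  exact: near_closest_point_const_ge0 hd hMc (ex_intro _ _ Mt) hdelta hr hCr.
have xr : enorm (x - r x) <= C_r * enorm (z (t + h) - x).
  apply: le_trans (hCr x Ux) _; rewrite ler_wpM2l//.
  by rewrite -enormN opprB; exact: dist_to_le.
rewrite -(subrKA x); apply: le_trans (ler_enormD _ _) _.
apply: le_trans (lerD (lexx _) xr) _.
rewrite [leLHS](_ : _ = (C_r + 1) * enorm (z (t + h) - x)); last by ring.
rewrite [leRHS](_ : _ = (C_r + 1) * (C_RK * h ^+ l.+1)); last by ring.
by rewrite ler_wpM2l// addr_ge0.
Qed.
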